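(* For every $\varepsilon>0$ there is $C$ such that for every finite poset $P$ with $n$ elements and every $X\subseteq P$ with $\sum_{x\in X}\mathrm{win}(x)\ge Cn$, there are distinct $x,y\in X$ with $\delta_{xy}>1/e-\varepsilon$.
   Context: $f$ is a uniformly random linear extension of $P$ (order-preserving bijection $P\to\{1,\dots,n\}$). For $x\in P$, $r(x)=\min\{f(y):y>x\}$ ($n+1$ if $x$ is maximal), $q(x)=\max\{f(y):y<x\}$ ($0$ if $x$ is minimal), and $\mathrm{win}(x)=\mathbb{E}[r(x)-q(x)]$. For distinct $x,y$, $\delta_{xy}=\min\{\Pr(f(x)<f(y)),\Pr(f(y)<f(x))\}$. *)

(* Defs.v *)
From HB Require Import structures.
From mathcomp Require Import all_boot all_order all_algebra.
From mathcomp Require Import reals.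

Set Implicit Arguments.
Unset Strict Implicit.
Unset Printing Implicit Defensive.

Import Order.TTheory GRing.Theory Num.Theory.
Local Open Scope ring_scope.

Section LinearExtensions.
Context {d : Order.disp_t} {P : finPOrderType d}.

(* The ordinals 'I_n count from 0; the value f(x) in {1, ..., n} is [pos f x]. *)
Definition is_linext (f : {ffun P -> 'I_#|P|}) : bool :=
  [&& injectiveb f, [forall k, k \in codom f]
    & [forall x, forall y, (x <= y)%O ==> (f x <= f y)%N]].

Lemma is_linextP (f : {ffun P -> 'I_#|P|}) :
  reflect (bijective f /\ forall x y : P, (x <= y)%O -> (f x <= f y)%N)
          (is_linext f).
Proof.
apply: (iffP and3P) => [[/injectiveP injf _ /'forall_forallP homf]|[bijf homf]].
  split=> [|x y]; last by apply/implyP.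
  by apply: inj_card_bij => //; rewrite card_ord.
split; first exact/injectiveP/bij_inj.
  by case: bijf => g _ gK; apply/forallP => k; rewrite -(gK k) codom_f.
by apply/'forall_forallP => x y; apply/implyP/homf.
Qed.

Definition linexts : {set {ffun P -> 'I_#|P|}} := [set f | is_linext f].

Definition pos (f : {ffun P -> 'I_#|P|}) (x : P) : nat := (f x).+1.

(* All values of [pos f] are at most n, so the neutral element n+1 is only
   reached when x is maximal. *)
Definition upper (f : {ffun P -> 'I_#|P|}) (x : P) : nat :=
  \big[minn/#|P|.+1]_(y | (x < y)%O) pos f y.

Definition lower (f : {ffun P -> 'I_#|P|}) (x : P) : nat :=
  \max_(y | (y < x)%O) pos f y.

Section Uniform.
Variable R : realType.

Definition expect (Z : {ffun P -> 'I_#|P|} -> R) : R :=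
  (\sum_(f in linexts) Z f) / #|linexts|%:R.

Definition prob (A : pred {ffun P -> 'I_#|P|}) : R :=
  #|[set f in linexts | A f]|%:R / #|linexts|%:R.

Definition win (x : P) : R :=
  expect (fun f => (upper f x)%:R - (lower f x)%:R).

Definition delta (x y : P) : R :=
  Num.min (prob (fun f => (pos f x < pos f y)%N))
          (prob (fun f => (pos f y < pos f x)%N)).
End Uniform.
End LinearExtensions.

(* Main.v *)
Require Import Defs.
From HB Require Import structures.
From mathcomp Require Import all_boot all_order all_algebra.
From mathcomp Require Import reals sequences exp.
From mathcomp Require Import perm zify ring lra.

(* Let [Om] be the set of order-preserving maps [g : P -> {0, ..., m}]. For
   m large, the order induced by a uniform element of [Om] is nearly a uniform
   linear extension, and the values are spread so that consecutive gaps have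
   equal means.

   In the coordinates [g i - g x] the set [Om] is stable under a shifted
   lattice operation, so the four functions theorem shows that the distribution
   function of [g y - g x] is log-concave. For such distributions Grunbaum's
   argument gives P(g y - g x <= K) >= 1/e - O(p) whenever K bounds the mean,
   where p is the largest point probability. Given the other values, [g x] is
   uniform in its window, whose mean length is about (m / n) win(x); together
   with log-concavity this forces p = O(n / (m win(x))).

   It remains to find x, y in X such that |E g x - E g y| is small compared to
   (m / n) win(x). Otherwise the intervals starting at E g x of length
   proportional to (m / n) win(x) are disjoint, which bounds the sum of
   win(x) over X by C n. *)

Import Order.TTheory GRing.Theory Num.Theory.
Set Implicit Arguments.
Unset Strict Implicit.
Unset Printing Implicit Defensive.

(** * The four functions theorem on a finite power of a finite chain *)

Section FourFunctions.
Variables (dT : Order.disp_t) (T : finOrderType dT) (I : finType).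

(** Since (p - a)(p - b) >= 0, p (a + b) <= p^2 + a b <= p (p + q); if p = 0 then a = b = 0. *)
Lemma leq_add_of_mul (p q a b : nat) :
  a <= p -> b <= p -> a * b <= p * q -> a + b <= p + q.
Proof. nia. Qed.

(** After symmetrizing the double sums, the terms of a pair i <= j are compared by [leq_add_of_mul]
    with p = c i * e j and q = c j * e i. *)
Lemma four_functions_chain (a b c e : T -> nat) :
    (forall i j, a i * b j <= c (Order.min i j) * e (Order.max i j)) ->
  (\sum_i a i) * (\sum_i b i) <= (\sum_i c i) * (\sum_i e i).
Proof.
move=> H.
have double (u v : T -> nat) : ((\sum_i u i) * (\sum_i v i)).*2 =
    \sum_i \sum_j (u i * v j + u j * v i).
  rewrite -addnn {2}big_distrlr exchange_big big_distrlr -big_split /=.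
  by apply: eq_bigr => i _; rewrite -big_split.
rewrite -leq_double !double; apply: leq_sum => i _; apply: leq_sum => j _.
wlog le_ij : i j / (i <= j)%O => [wl|].
  case/orP: (le_total i j) => [|le_ji]; first exact: wl.
  by rewrite addnC [X in _ <= X]addnC; apply: wl.
have := H i j; rewrite (min_idPl le_ij) (max_idPr le_ij) => Hij.
have := H j i; rewrite (min_idPr le_ij) (max_idPl le_ij) => Hji.
have := H i i; rewrite minxx maxxx => Hii.
have := H j j; rewrite minxx maxxx => Hjj.
apply: leq_add_of_mul => //.
by have := leq_mul Hii Hjj; lia.
Qed.

Implicit Types (g h : {ffun I -> T}) (F : {ffun I -> T} -> nat).

Definition set_coord g i t : {ffun I -> T} :=
  [ffun j => if j == i then t else g j].
Definition ffun_min g h : {ffun I -> T} := [ffun i => Order.min (g i) (h i)].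
Definition ffun_max g h : {ffun I -> T} := [ffun i => Order.max (g i) (h i)].

Fixpoint partial_sum (l : seq I) F g : nat :=
  if l is i :: l' then \sum_t partial_sum l' F (set_coord g i t) else F g.

Lemma partial_sumE l F g : uniq l ->
  partial_sum l F g =
  \sum_(h : {ffun I -> T} | [forall j, (j \notin l) ==> (h j == g j)]) F h.
Proof.
elim: l g => [|i l IHl] g /=.
  move=> _; rewrite (big_pred1 g) // => h; apply/forallP/eqP => [H|-> //].
  by apply/ffunP => j; apply/eqP; have := H j.
case/andP=> il ul.
rewrite [RHS](partition_big (fun h : {ffun I -> T} => h i) predT) //=.
apply: eq_bigr => t _; rewrite IHl //; apply: eq_bigl => h.
apply/forallP/andP => [H|[/forallP H /eqP hi] j].
  split; last by have := H i; rewrite il ffunE eqxx.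
  apply/forallP => j; apply/implyP; rewrite inE negb_or => /andP[ji jl].
  by have := H j; rewrite jl ffunE (negPf ji).
apply/implyP => jl; rewrite ffunE; case: (eqVneq j i) => [->|ji].
  exact/eqP.
by have := H j; rewrite inE (negPf ji) jl.
Qed.

Lemma four_functions_partial l F1 F2 F3 F4 :
    (forall g h, F1 g * F2 h <= F3 (ffun_min g h) * F4 (ffun_max g h)) ->
  forall g h, partial_sum l F1 g * partial_sum l F2 h <=
    partial_sum l F3 (ffun_min g h) * partial_sum l F4 (ffun_max g h).
Proof.
move=> H; elim: l => //= i l IHl g h; apply: four_functions_chain => t u.
suff [-> ->] :
    set_coord (ffun_min g h) i (Order.min t u) =
      ffun_min (set_coord g i t) (set_coord h i u) /\
    set_coord (ffun_max g h) i (Order.max t u) =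
      ffun_max (set_coord g i t) (set_coord h i u) by apply: IHl.
by split; apply/ffunP => j; rewrite !ffunE; case: eqP.
Qed.

Lemma four_functions_card (A B C E : {set {ffun I -> T}}) :
    (forall g h, g \in A -> h \in B ->
       (ffun_min g h \in C) /\ (ffun_max g h \in E)) ->
  #|A| * #|B| <= #|C| * #|E|.
Proof.
move=> H; have [->|[g0 _]] := set_0Vmem A; first by rewrite cards0.
(* The functions are the indicators of the four sets; summing out every coordinate turns them into
   cardinalities. *)
pose ind (S : {set {ffun I -> T}}) g : nat := g \in S.
have indE S g : partial_sum (enum I) (ind S) g = #|S|.
  rewrite partial_sumE ?enum_uniq // -sum1_card [RHS]big_mkcond /=.
  apply: eq_big => [h|h _]; first by apply/forallP => j; rewrite mem_enum.
  by rewrite /ind; case: (h \in S).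
have := @four_functions_partial (enum I) (ind A) (ind B) (ind C) (ind E) _
  g0 g0.
rewrite !indE; apply=> g h; rewrite /ind.
have [gA|] := boolP (g \in A); last by rewrite mul0n.
have [hB|] := boolP (h \in B); last by rewrite muln0.
by have [-> ->] := H _ _ gA hB.
Qed.

End FourFunctions.

(** * Log-concavity of differences of monotone maps *)

Section MonotoneMaps.
Context {d : Order.disp_t} {P : finPOrderType d}.
Variable m : nat.
Implicit Types (g h : {ffun P -> 'I_m.+1}) (x y : P).

Definition monotone_maps : {set {ffun P -> 'I_m.+1}} :=
  [set g : {ffun P -> 'I_m.+1} |
    [forall x, forall y, (x <= y)%O ==> (g x <= g y)]].

Lemma monotone_mapsP g :
  reflect (forall x y, (x <= y)%O -> g x <= g y) (g \in monotone_maps).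
Proof.
rewrite inE; apply: (iffP 'forall_forallP) => H x y; last exact/implyP/H.
by apply/implyP.
Qed.

(** Over the integers the condition is g y - g x <= j - m. As a function of j the cardinality is an
    unnormalized distribution function. *)
Definition diff_le x y j : {set {ffun P -> 'I_m.+1}} :=
  [set g : {ffun P -> 'I_m.+1} in monotone_maps | g y + m <= g x + j].

(* The coordinates [g i - g x] (and [- g x] in place of [g x]), in which
   monotonicity, the bounds 0 <= g <= m and [g y - g x <= k] become conditions
   on differences of coordinates, hence are stable under min, max and
   translation. The shift by [m.+1 - e] keeps them nonnegative. *)
Definition rel_coord x (e : nat) g : {ffun P -> 'I_(m + m).+2} :=
  [ffun i => inord (if i == x then m.+1 - e - g x else m.+1 - e + g i - g x)].

Lemma val_rel_coord x e g i : e <= 1 ->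
  rel_coord x e g i =
    (if i == x then m.+1 - e - g x else m.+1 - e + g i - g x) :> nat.
Proof.
move=> e1; rewrite ffunE inordK //.
by have := ltn_ord (g i); have := ltn_ord (g x); case: ifP; lia.
Qed.

Lemma rel_coord_inj x e : e <= 1 -> injective (rel_coord x e).
Proof.
move=> e1 g h E; have Ev i := congr1 (fun f : {ffun P -> 'I__} => f i : nat) E.
have Ex := Ev x; rewrite /= !val_rel_coord // eqxx in Ex.
have gx := ltn_ord (g x); have hx := ltn_ord (h x).
apply/ffunP => i; apply: val_inj => /=.
have := Ev i; rewrite /= !val_rel_coord //.
have := ltn_ord (g i); have := ltn_ord (h i).
by case: eqP => [->|_]; lia.
Qed.

Lemma val_min_ord N (a b : 'I_N) : Order.min a b = minn a b :> nat.
Proof. by rewrite /Order.min ltEord; case: ifP; lia. Qed.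

Lemma val_max_ord N (a b : 'I_N) : Order.max a b = maxn a b :> nat.
Proof. by rewrite /Order.max ltEord; case: ifP; lia. Qed.

(** The sets of levels j and j + 2 are read with shifts 0 and 1; for y distinct from x this bounds
    coordinate y by j + 1 and j + 2. The minimum and the maximum inherit these bounds, and reading
    them with shifts 1 and 0 puts both at level j + 1. *)
Lemma diff_le_log_concave x y j :
  #|diff_le x y j| * #|diff_le x y j.+2| <= #|diff_le x y j.+1| ^ 2.
Proof.
rewrite -(card_imset _ (@rel_coord_inj x 0 isT)).
rewrite -(card_imset (diff_le x y j.+2) (@rel_coord_inj x 1 isT)).
rewrite expnS expn1 -{1}(card_imset _ (@rel_coord_inj x 1 isT)).
rewrite -(card_imset (diff_le x y j.+1) (@rel_coord_inj x 0 isT)).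
apply: four_functions_card => _ _ /imsetP[g + ->] /imsetP[h + ->].
move=> /setIdP[/monotone_mapsP mg gj] /setIdP[/monotone_mapsP mh hj].
pose G (i : P) : nat := g i; pose H (i : P) : nat := h i.
have gm i : G i <= m by rewrite -ltnS ltn_ord.
have hm i : H i <= m by rewrite -ltnS ltn_ord.
have mG a b : (a <= b)%O -> G a <= G b by apply: mg.
have mH a b : (a <= b)%O -> H a <= H b by apply: mh.
have cg i : rel_coord x 0 g i =
    (if i == x then m.+1 - G x else m.+1 + G i - G x) :> nat.
  by rewrite val_rel_coord // subn0.
have ch i : rel_coord x 1 h i =
    (if i == x then m - H x else m + H i - H x) :> nat.
  by rewrite val_rel_coord // subn1.
rewrite -/(G x) -/(G y) in gj; rewrite -/(H x) -/(H y) in hj.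
move: G H gm hm mG mH cg ch gj hj => G H gm hm mG mH cg ch gj hj.
split.
(* The map with k i - k x = min (g i - g x + 1, h i - h x) and k x = max (g x - 1, h x), written
   with a single subtraction. *)
- pose k : {ffun P -> 'I_m.+1} := [ffun i =>
    inord (minn (G i + H x + 1) (H i + G x) - minn (G x) (H x).+1)].
  have kE (i : P) :
      k i = minn (G i + H x + 1) (H i + G x) - minn (G x) (H x).+1 :> nat.
    by rewrite ffunE inordK //; move: (gm i) (hm i) (gm x) (hm x); lia.
  apply/imsetP; exists k.
    apply/setIdP; split; last by rewrite !kE; lia.
    apply/monotone_mapsP => a b ab; rewrite !kE.
    by have := mG _ _ ab; have := mH _ _ ab; lia.
  apply/ffunP => i; apply: val_inj; rewrite /= ffunE val_min_ord.
  rewrite cg ch val_rel_coord // !kE.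
  by move: (gm i) (hm i) (gm x) (hm x); case: eqP => [->|_]; lia.
(* Dually, k i - k x = max (g i - g x, h i - h x - 1) and k x = min (g x, h x + 1). *)
- pose k : {ffun P -> 'I_m.+1} := [ffun i =>
    inord (maxn (G i + H x + 1) (H i + G x) - maxn (G x) (H x).+1)].
  have kE (i : P) :
      k i = maxn (G i + H x + 1) (H i + G x) - maxn (G x) (H x).+1 :> nat.
    by rewrite ffunE inordK //; move: (gm i) (hm i) (gm x) (hm x); lia.
  apply/imsetP; exists k.
    apply/setIdP; split; last by rewrite !kE; lia.
    apply/monotone_mapsP => a b ab; rewrite !kE.
    by have := mG _ _ ab; have := mH _ _ ab; lia.
  apply/ffunP => i; apply: val_inj; rewrite /= ffunE val_max_ord.
  rewrite cg ch val_rel_coord // !kE.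
  by move: (gm i) (hm i) (gm x) (hm x); case: eqP => [->|_]; lia.
Qed.

End MonotoneMaps.

(** * Log-concave sequences and Grunbaum's inequality *)

Section LogConcaveSequence.
Variable N : nat -> nat.
Hypothesis N_mono : {homo N : i j / i <= j}.
Hypothesis N_lc : forall j, N j * N j.+2 <= N j.+1 ^ 2.

(** The ratios N (k + 1) / N k are nonincreasing; monotonicity excludes zeros after a positive
    value, so common factors can be cancelled. *)
Lemma log_concave_ratio j k : j <= k -> N j * N k.+1 <= N j.+1 * N k.
Proof.
move=> /subnKC <-; elim: (k - j) => [|i IHi]; first by rewrite addn0 mulnC.
rewrite addnS; set l := (j + i) in IHi *.
have [Nl0|Nl_gt0] := posnP (N l).
  suff -> : N j = 0 by [].
  by apply/eqP; rewrite -leqn0 -Nl0 N_mono // leq_addr.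
have NlS_gt0 : 0 < N l.+1 by apply: leq_trans Nl_gt0 (N_mono (leqnSn l)).
have NN_gt0 : 0 < N l * N l.+1 by rewrite muln_gt0 Nl_gt0.
rewrite -(leq_pmul2r NN_gt0).
have := leq_mul IHi (N_lc l); lia.
Qed.

(** By [log_concave_ratio], (N k.+1 - N k) * N n <= N k * (N n.+1 - N n) for n <= k, and this
    telescopes over n. *)
Lemma log_concave_sum_aux k n : n <= k.+1 ->
  (N k.+1 - N k) * (\sum_(j < n) N j) <= N k * N n.
Proof.
elim: n => [|n IHn] ltnk; first by rewrite big_ord0 muln0.
rewrite big_ord_recr /= mulnDr.
have := IHn (ltnW ltnk); have := @log_concave_ratio n k ltnk.
have [q ->] : exists q, N k.+1 = N k + q.
  by exists (N k.+1 - N k); rewrite subnKC // N_mono.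
rewrite addKn; move: (\sum_(j < n) N j) => S; lia.
Qed.

Lemma log_concave_sum k :
  (N k.+1 - N k) * (\sum_(j < k.+1) N j) <= N k * N k.+1.
Proof. exact: log_concave_sum_aux. Qed.

Section Grunbaum.
Variables (R : realType) (A K : nat).
Hypothesis N_sup : exists L, N L = A.
Hypothesis A_gt0 : 0 < A.
(* For a random variable with distribution function [N / A] this says that its
   mean is at most [K]. *)
Hypothesis N_mean : forall l, l * A <= \sum_(j < K + l) N j.
Local Open Scope ring_scope.

Let phi : R := (N K)%:R.
Let p : R := (N K.+1 - N K)%:R.

Lemma log_concave_cdf_gt0 : (0 < N K)%N.
Proof.
rewrite lt0n; apply/eqP => NK0; have := N_mean 1.
have -> : (\sum_(j < K + 1) N j = 0)%N.
  apply: big1 => j _; have : (N j <= N K)%N.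
    by apply: N_mono; have := ltn_ord j; rewrite {2}addn1 ltnS.
  by rewrite NK0 leqn0 => /eqP.
by rewrite mul1n leqNgt A_gt0.
Qed.

Let phi_gt0 : 0 < phi. Proof. by rewrite ltr0n log_concave_cdf_gt0. Qed.
Let p_ge0 : 0 <= p. Proof. exact: ler0n. Qed.
Let NKS : (N K.+1)%:R = phi + p.
Proof. by rewrite -natrD subnKC // N_mono. Qed.

Lemma log_concave_geometric i : (N (K + i))%:R <= phi * (1 + p / phi) ^+ i.
Proof.
elim: i => [|i IHi]; first by rewrite addn0 expr0 mulr1.
have := log_concave_ratio (leq_addr i K).
rewrite -(ler_nat R) !natrM -/phi NKS -addnS => H.
apply: le_trans (_ : (1 + p / phi) * (N (K + i))%:R <= _); last first.
  by rewrite exprS mulrCA ler_wpM2l // addr_ge0 // divr_ge0 // ltW.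
rewrite -(ler_pM2l phi_gt0); apply: (le_trans H).
by rewrite mulrA mulrDr mulr1 mulrCA divff ?mulr1 // gt_eqF.
Qed.

(** The terms before K contribute at most phi^2 by [log_concave_sum_aux], and the later ones are
    dominated by a geometric series of ratio 1 + p / phi. *)
Lemma log_concave_sum_above l :
  p * (\sum_(j < K + l) N j)%:R <= phi ^+ 2 * (1 + p / phi) ^+ l.
Proof.
elim: l => [|l IHl].
  rewrite addn0 expr0 mulr1 -natrM -natrX ler_nat expnS expn1.
  exact: log_concave_sum_aux.
rewrite addnS big_ord_recr /= natrD mulrDr.
have := ler_wpM2l p_ge0 (log_concave_geometric l).
set q := _ ^+ l in IHl *; move=> H.
apply: (le_trans (lerD IHl H)).
rewrite [_ ^+ l.+1]exprS -/q le_eqVlt; apply/orP; left; apply/eqP.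
have aux (a b c : R) : a != 0 ->
    a ^+ 2 * c + b * (a * c) = a ^+ 2 * ((1 + b / a) * c) by move=> ?; field.
by apply: aux; rewrite gt_eqF.
Qed.

(* Applying [log_concave_sum_above] with [l] close to [phi / p] gives
   [A <= phi * e^(1 + p / phi)]. *)
Lemma log_concave_grunbaum : A%:R / expR 1 <= phi + expR 1 * p.
Proof.
have A0 : 0 < A%:R :> R by rewrite ltr0n.
have e_ge2 : 2 <= expR 1 :> R by have := expR_ge1Dx (1 : R); lra.
have e0 : 0 < expR 1 :> R by exact: expR_gt0.
(* With no mass at K + 1 the sequence is constant from K on, so phi is at least A. *)
have [p0|p_neq0] := eqVneq p 0.
  have [L NL] := N_sup; rewrite p0 mulr0 addr0.
  suff Aphi : A%:R <= phi.
    apply: le_trans Aphi; rewrite ler_pdivrMr // ler_peMr ?ltW //; lra.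
  have [LK|/ltnW KL] := leqP L K; first by rewrite ler_nat -NL N_mono.
  have := log_concave_geometric (L - K); rewrite subnKC // NL.
  by rewrite p0 mul0r addr0 expr1n mulr1.
have p_gt0 : 0 < p by rewrite lt_def p_neq0.
set a := p / phi; have a_gt0 : 0 < a by rewrite divr_gt0.
have aphi : a * phi = p by rewrite /a divfK // gt_eqF.
(* [N_mean] bounds the sum in [log_concave_sum_above] from below; one factor phi cancels. *)
have key l : a * l%:R * A%:R <= phi * (1 + a) ^+ l.
  rewrite -(ler_pM2l phi_gt0) [leRHS]mulrA -expr2.
  apply: le_trans (log_concave_sum_above l).
  have aux (u v w z : R) : u * (v * w * z) = v * u * (w * z) by ring.
  rewrite aux aphi.
  by rewrite ler_wpM2l // -natrM ler_nat.
(* If a >= 1, then l = 1 already gives A <= 2 phi <= e phi. *)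
have [a_ge1|a_lt1] := leP 1 a.
  have := key 1%N; rewrite expr1 mulr1 => k1.
  have A_le2 : A%:R <= phi * 2.
    rewrite -(ler_pM2l a_gt0) (le_trans k1) // mulrCA ler_pM2l //; lra.
  have : A%:R / expR 1 <= phi.
    by rewrite ler_pdivrMr // (le_trans A_le2) // ler_wpM2l // ltW.
  have : 0 <= expR 1 * p by rewrite mulr_ge0 // ltW.
  lra.
(* Rounding 1 / a up to an integer costs at most a in the exponent: (1 + a)^l <= e^(a l) <= e^(1 +
   a). *)
have [l l1 l2] : exists2 l : nat, 1 <= a * l%:R & a * l%:R <= 1 + a.
  exists (Num.truncn a^-1).+1.
    rewrite -ler_pdivrMl // mulr1 ltW // truncnS_gt //.
  rewrite -natr1 mulrDr mulr1 lerD2r -ler_pdivlMl // mulr1.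
  by rewrite truncn_le // invr_ge0 ltW.
have pow_le : (1 + a) ^+ l <= expR (1 + a).
  apply: (@le_trans _ _ (expR a ^+ l)).
    by rewrite lerXn2r ?nnegrE ?expR_ge1Dx ?expR_ge0 // addr_ge0 // ltW.
  by rewrite -expRM_natl ler_expR mulr_natl -mulr_natr.
have A_le : A%:R <= phi * expR 1 * expR a.
  have H := key l; rewrite -mulrA -expRD.
  apply: le_trans (_ : phi * (1 + a) ^+ l <= _); last by rewrite ler_pM2l.
  apply: le_trans H; rewrite ler_peMl // ltW //.
have A_le2 : A%:R <= phi * expR 1 * expR 1.
  apply: (le_trans A_le); by rewrite ler_pM2l ?mulr_gt0 // ler_expR ltW.
(* The factor e^a is linearized by e^(-a) >= 1 - a; the remainder A a is at most e^2 p because A <=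
   e^2 phi and a phi = p. *)
have A_ge : A%:R * (1 - a) <= phi * expR 1.
  have : expR a * expR (- a) = 1 by rewrite -expRD subrr expR0.
  have := expR_ge1Dx (- a); have := expR_gt0 (- a); have := expR_gt0 a.
  move: (expR a) (expR (- a)) A_le => u v A_le u0 v0 uv E.
  have : A%:R * v <= phi * expR 1.
    by have := ler_wpM2r (ltW v0) A_le; rewrite -[leRHS]mulrA E mulr1.
  by apply: le_trans; rewrite ler_wpM2l // ltW.
rewrite ler_pdivrMr //.
have : A%:R * a <= expR 1 * expR 1 * p.
  rewrite -aphi; have := ler_wpM2r (ltW a_gt0) A_le2; lra.
lra.
Qed.

End Grunbaum.
End LogConcaveSequence.

(** * Differences of values: point probabilities and windows *)

Section Differences.
Context {d : Order.disp_t} {P : finPOrderType d}.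
Variable m : nat.
Implicit Types (g h : {ffun P -> 'I_m.+1}) (x y z : P).
Local Notation Om := (@monotone_maps d P m).
Local Notation maps := {ffun P -> 'I_m.+1}.

Definition diff_eq x y k : {set {ffun P -> 'I_m.+1}} :=
  [set g : {ffun P -> 'I_m.+1} in Om | g y + m == g x + k].

Definition diff_lt x y : {set {ffun P -> 'I_m.+1}} :=
  [set g : {ffun P -> 'I_m.+1} in Om | g x < g y].

Lemma mem_diff_le x y j g :
  (g \in diff_le m x y j) = (g \in Om) && (g y + m <= g x + j).
Proof. by rewrite in_set. Qed.

Lemma mem_diff_eq x y k g :
  (g \in diff_eq x y k) = (g \in Om) && (g y + m == g x + k).
Proof. by rewrite in_set. Qed.

Lemma mem_diff_lt x y g : (g \in diff_lt x y) = (g \in Om) && (g x < g y).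
Proof. by rewrite in_set. Qed.

Lemma leq_ffun_ord g x : g x <= m.
Proof. by rewrite -ltnS ltn_ord. Qed.

Lemma diff_le_mono x y : {homo (fun j => #|diff_le m x y j|) : i j / i <= j}.
Proof.
move=> i j ij; apply/subset_leq_card/subsetP => g /setIdP[gO gi].
by apply/setIdP; split=> //; apply: leq_trans gi _; rewrite leq_add2l.
Qed.

Lemma diff_le_card x y j : #|diff_le m x y j| <= #|Om|.
Proof. by apply/subset_leq_card/subsetP => g /setIdP[]. Qed.

Lemma diff_le_sup x y : #|diff_le m x y (m + m)| = #|Om|.
Proof.
apply: eq_card => g; apply/idP/idP => [/setIdP[] //|gO].
apply/setIdP; split=> //.
by have := leq_ffun_ord g y; have := leq_ffun_ord g x; lia.
Qed.

Lemma diff_leS x y k :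
  #|diff_le m x y k.+1| = #|diff_le m x y k| + #|diff_eq x y k.+1|.
Proof.
rewrite -cardsUI [X in _ = _ + X](_ : _ = 0) ?addn0.
  apply: eq_card => g; rewrite in_setU !mem_diff_le mem_diff_eq -andb_orr.
  by congr (_ && _); lia.
apply/eqP; rewrite cards_eq0 -subset0; apply/subsetP => g.
rewrite in_setI mem_diff_le mem_diff_eq => /andP[/andP[_ a] /andP[_ b]].
by move: a b; lia.
Qed.

Lemma diff_le_lt x y :
  #|diff_le m x y m| <= #|diff_lt y x| + #|diff_eq x y m|.
Proof.
apply: leq_trans (leq_card_setU _ _).
apply/subset_leq_card/subsetP => g; rewrite in_setU mem_diff_le.
rewrite mem_diff_lt mem_diff_eq -andb_orr => /andP[-> /=]; lia.
Qed.

Lemma sum_leq_ord a b K : a <= b -> \sum_(j < K) (b <= a + j) = a + K - b.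
Proof.
move=> ab; elim: K => [|K IHK]; first by rewrite big_ord0; lia.
by rewrite big_ord_recr /= IHK; case: leqP; lia.
Qed.

(** Counting the pairs (j, g) both ways: summing a distribution function gives a total of positive
    parts. *)
Lemma sum_diff_le x y K :
  \sum_(j < K) #|diff_le m x y j| =
  \sum_(g : maps | g \in Om) (g x + K - (g y + m)).
Proof.
transitivity (\sum_(j < K) \sum_(g : maps | g \in Om) (g y + m <= g x + j)).
  apply: eq_bigr => j _; rewrite -sum1_card big_mkcond [RHS]big_mkcond /=.
  apply: eq_bigr => g _; rewrite mem_diff_le.
  by case: (g \in Om) => //; case: leqP.
rewrite exchange_big; apply: eq_bigr => g _ /=; apply: sum_leq_ord.
by have := leq_ffun_ord g x; lia.
Qed.

(** By [log_concave_sum], a large point mass at k forces a small mean deviation below k. *)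
Lemma diff_eq_half_spread x y k :
  #|diff_eq x y k| * (\sum_(g : maps | g \in Om) (g x + k - (g y + m))) <=
  #|Om| ^ 2.
Proof.
case: k => [|k].
  rewrite big1 ?muln0 // => g _.
  by have := leq_ffun_ord g x; lia.
rewrite -sum_diff_le.
have := log_concave_sum (@diff_le_mono x y) (@diff_le_log_concave _ _ m x y) k.
rewrite {1}diff_leS addKn => /leq_trans; apply.
by rewrite expnS expn1 leq_mul // diff_le_card.
Qed.

Lemma diff_eqC x y k : k <= m + m -> diff_eq y x (m + m - k) = diff_eq x y k.
Proof.
move=> km; apply/setP => g; rewrite !mem_diff_eq; congr (_ && _).
by have := leq_ffun_ord g x; have := leq_ffun_ord g y; lia.
Qed.

Lemma diff_eq_empty x y k : m + m < k -> diff_eq x y k = set0.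
Proof.
move=> mk; apply/setP => g; rewrite mem_diff_eq in_set0; apply/negbTE.
by have := leq_ffun_ord g x; have := leq_ffun_ord g y; lia.
Qed.

Definition diff_dist x y k g : nat :=
  (g x + k - (g y + m)) + (g y + m - (g x + k)).

(** The deviations above k are those below m + m - k after exchanging x and y. *)
Lemma diff_eq_spread x y k :
  #|diff_eq x y k| * (\sum_(g : maps | g \in Om) diff_dist x y k g) <=
  2 * #|Om| ^ 2.
Proof.
have [km|mk] := leqP k (m + m); last by rewrite diff_eq_empty // cards0.
rewrite big_split mulnDr mul2n -addnn leq_add ?diff_eq_half_spread //.
rewrite -diff_eqC //.
have := diff_eq_half_spread y x (m + m - k); apply: leq_trans.
rewrite leq_mul2l; apply/orP; right; apply: leq_sum => g _.
by have := leq_ffun_ord g x; have := leq_ffun_ord g y; lia.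
Qed.

(** The ends of the interval in which [g x] can move with the other values fixed; the defaults 0 and
    m are the limits of the range. *)
Definition win_lo g x : nat := \max_(z | (z < x)%O) g z.
Definition win_hi g x : nat := \big[minn/m]_(z | (x < z)%O) g z.
Definition win_width g x : nat := win_hi g x - win_lo g x.

Lemma leq_bigmin (I : finType) (Q : pred I) (F : I -> nat) a b :
  (b <= \big[minn/a]_(i | Q i) F i) =
    (b <= a) && [forall i, Q i ==> (b <= F i)].
Proof.
rewrite -big_andE; elim/big_rec2: _ => [|i u v Qi E]; first by rewrite andbT.
by rewrite leq_min E andbCA.
Qed.

Lemma win_hi_le g x z : (x < z)%O -> win_hi g x <= g z.
Proof.
move=> xz; have := leqnn (win_hi g x); rewrite {2}/win_hi leq_bigmin.
by case/andP=> _ /forallP /(_ z); rewrite xz.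
Qed.

Lemma win_hi_lem g x : win_hi g x <= m.
Proof.
by have := leqnn (win_hi g x); rewrite {2}/win_hi leq_bigmin => /andP[].
Qed.

Lemma win_lo_ge g x z : (z < x)%O -> g z <= win_lo g x.
Proof. by move=> zx; apply: (@leq_bigmax_cond _ _ (fun z => g z : nat)). Qed.

Lemma win_lo_hi g x : g \in Om -> win_lo g x <= g x <= win_hi g x.
Proof.
move/monotone_mapsP=> mg; apply/andP; split.
  by apply/bigmax_leqP => z zx; apply: mg; apply: ltW.
rewrite leq_bigmin leq_ffun_ord; apply/forallP => z; apply/implyP => xz.
by apply: mg; apply: ltW.
Qed.

(* A cyclic move of [g x] by half of its window: it preserves the uniform
   distribution and displaces [g x] by at least half of the width. *)
Definition win_rot_val x g : nat :=
  let b := g x + uphalf (win_width g x) in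
  if b <= win_hi g x then b else b - (win_width g x).+1.
Definition win_rot x g : {ffun P -> 'I_m.+1} :=
  [ffun z => if z == x then inord (win_rot_val x g) else g z].

Lemma win_rot_val_bounds x g : g \in Om ->
  win_lo g x <= win_rot_val x g <= win_hi g x.
Proof.
by move/(win_lo_hi x); rewrite /win_rot_val /win_width; case: ifP; lia.
Qed.

Lemma win_rotE x g : g \in Om -> win_rot x g x = win_rot_val x g :> nat.
Proof.
move=> gO; rewrite ffunE eqxx inordK // ltnS.
by have /andP[_ /leq_trans->] := win_rot_val_bounds x gO; rewrite ?win_hi_lem.
Qed.

Lemma win_rot_neq x g z : z != x -> win_rot x g z = g z.
Proof. by move=> zx; rewrite ffunE (negPf zx). Qed.

Lemma eq_win g h x : (forall z, z != x -> g z = h z) ->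
  (win_lo g x = win_lo h x) * (win_hi g x = win_hi h x).
Proof.
move=> E; split; apply: eq_bigr => z; rewrite lt_neqAle => /andP[zx _].
  by rewrite E.
by rewrite E // eq_sym.
Qed.

Lemma win_rot_mem x g : g \in Om -> win_rot x g \in Om.
Proof.
move=> gO; have /monotone_mapsP mg := gO; apply/monotone_mapsP => a b ab.
have /andP[lo hi] := win_rot_val_bounds x gO.
have [ax|ax] := eqVneq a x; have [bx|bx] := eqVneq b x.
- by rewrite ax bx.
- rewrite ax win_rotE // win_rot_neq //; apply: leq_trans hi (win_hi_le _ _).
  by rewrite lt_neqAle eq_sym bx -ax.
- rewrite bx win_rotE // win_rot_neq //; apply: leq_trans lo; apply: win_lo_ge.
  by rewrite lt_neqAle ax -bx.
- by rewrite !win_rot_neq // mg.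
Qed.

(** [win_rot] keeps the other values, hence the window, and acts on the window as a cyclic shift. *)
Lemma win_rot_inj x : {in Om &, injective (win_rot x)}.
Proof.
move=> g h gO hO E.
have Ez z : z != x -> g z = h z.
  by move=> zx; rewrite -(win_rot_neq g zx) E win_rot_neq.
have [lo hi] := eq_win Ez; apply/ffunP => z; apply: val_inj => /=.
have [->|/Ez -> //] := eqVneq z x.
have := congr1 (fun f : {ffun P -> 'I_m.+1} => f x : nat) E.
rewrite /= !win_rotE // /win_rot_val /win_width lo hi.
have := win_lo_hi x gO; have := win_lo_hi x hO; rewrite lo hi.
by case: ifP; case: ifP; lia.
Qed.

Lemma sum_win_rot x (F : {ffun P -> 'I_m.+1} -> nat) :
  \sum_(g : maps | g \in Om) F (win_rot x g) = \sum_(g : maps | g \in Om) F g.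
Proof.
rewrite -(big_imset _ (@win_rot_inj x)); apply: eq_bigl.
apply/subset_cardP; first by rewrite card_in_imset //; apply: win_rot_inj.
by apply/subsetP => _ /imsetP[g gO ->]; apply: win_rot_mem.
Qed.

(** The maps g and [win_rot x g] agree at y and differ at x by at least half the width, so their two
    distances add up to at least that; by [sum_win_rot] both have the same total. *)
Lemma win_width_le_dist x y k : x != y ->
  \sum_(g : maps | g \in Om) win_width g x <=
  4 * \sum_(g : maps | g \in Om) diff_dist x y k g.
Proof.
move=> xy; rewrite (_ : 4 = 2 * 2) // -mulnA [X in _ <= 2 * X]mul2n -addnn.
rewrite -{2}(sum_win_rot x (diff_dist x y k)) -big_split big_distrr /=.
apply: leq_sum => g gO; rewrite /diff_dist win_rotE // win_rot_neq 1?eq_sym //.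
have := win_lo_hi x gO; rewrite /win_rot_val /win_width.
by move: (nat_of_ord (g y)) (nat_of_ord (g x)) => u v; case: ifP; lia.
Qed.

Lemma diff_eq_win_width x y k : x != y ->
  #|diff_eq x y k| * (\sum_(g : maps | g \in Om) win_width g x) <=
  8 * #|Om| ^ 2.
Proof.
move=> xy; apply: leq_trans (leq_mul (leqnn _) (win_width_le_dist k xy)) _.
by rewrite mulnCA (_ : 8 = 4 * 2) // -mulnA leq_mul2l diff_eq_spread.
Qed.

Lemma diff_eq_win_widthC x y k : x != y ->
  #|diff_eq y x k| * (\sum_(g : maps | g \in Om) win_width g x) <=
  8 * #|Om| ^ 2.
Proof.
move=> xy; have [km|mk] := leqP k (m + m); last first.
  by rewrite diff_eq_empty // cards0.
by rewrite -diff_eqC //; apply: diff_eq_win_width.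
Qed.

Lemma monotone_maps_gt0 : 0 < #|Om|.
Proof.
apply/card_gt0P; exists [ffun=> ord0]; apply/monotone_mapsP => a b _.
by rewrite !ffunE.
Qed.

(** Grunbaum's inequality bounds the number of maps with g y - g x <= k from below. Passing to g y <
    g x removes the k + 1 differences 0, ..., k, each a point mass controlled by the first
    hypothesis. *)
Lemma diff_lt_grunbaum (R : realType) x y (W k : nat) :
    (forall j, #|diff_eq x y j| * W <= 8 * #|Om| ^ 2) ->
    \sum_(g : maps | g \in Om) g y <=
      \sum_(g : maps | g \in Om) g x + k * #|Om| ->
  (W%:R * (#|Om|%:R / expR 1) <= W%:R * #|diff_lt y x|%:R +
     8 * (expR 1 + k.+1%:R) * #|Om|%:R ^+ 2 :> R)%R.
Proof.
move=> HW Hk; pose A := #|Om|.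
(* The mean of the positive part of k + l - (g y - g x) is at least l, since g y - g x has mean at
   most k. *)
have mean l : l * A <= \sum_(j < m + k + l) #|diff_le m x y j|.
  rewrite sum_diff_le.
  have : \sum_(g : maps | g \in Om) (g x + (m + k + l)) <=
      \sum_(g : maps | g \in Om) (g x + (m + k + l) - (g y + m)) +
      \sum_(g : maps | g \in Om) (g y + m).
    by rewrite -big_split; apply: leq_sum => g _ /=; lia.
  have aux u v w a b c n : u <= v + b * a ->
      v + (a * n + a * b + a * c) <= w + (u + a * n) -> c * a <= w by lia.
  by rewrite !big_split !sum_nat_const; apply: aux.
have := @log_concave_grunbaum _ (@diff_le_mono x y)
  (@diff_le_log_concave _ _ m x y) R A (m + k)
  (ex_intro _ _ (diff_le_sup x y)) monotone_maps_gt0 mean.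
rewrite diff_leS addKn => G.
have lt_le : #|diff_le m x y (m + k)| * W <=
    #|diff_lt y x| * W + k.+1 * (8 * A ^ 2).
  elim: {Hk mean G} k => [|k IHk].
    rewrite addn0 mul1n.
    apply: leq_trans (leq_mul (diff_le_lt _ _) (leqnn _)) _.
    by rewrite mulnDl leq_add2l.
  rewrite addnS diff_leS mulnDl [k.+2 * _]mulSnr addnA.
  exact: leq_add IHk (HW _).
move: lt_le (HW (m + k).+1); rewrite -!(ler_nat R) natrD !natrM => H1 H2.
have W0 : (0 <= W%:R :> R)%R by rewrite ler0n.
have e0 : (0 < expR 1 :> R)%R by exact: expR_gt0.
have G' := ler_wpM2l W0 G; have H2' := ler_wpM2l (ltW e0) H2.
move: G' H1 H2'; rewrite -/A; lra.
Qed.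

End Differences.

(** * Linear extensions as rank functions *)

Section Ranks.
Context {d : Order.disp_t} {P : finPOrderType d}.
Local Notation n := #|P|.
Implicit Types (x y z : P) (kappa : P -> nat).

Lemma rank_subproof kappa x : #|[set y | kappa y < kappa x]| < n.
Proof.
rewrite -cardsT; apply/proper_card/properP; split; first exact: subsetT.
by exists x; rewrite ?in_setT // in_set ltnn.
Qed.

Definition rank kappa : {ffun P -> 'I_n} :=
  [ffun x => Ordinal (rank_subproof kappa x)].

Lemma rankE kappa x : rank kappa x = #|[set y | kappa y < kappa x]| :> nat.
Proof. by rewrite ffunE. Qed.

Lemma ltn_rank kappa x y : kappa x < kappa y -> rank kappa x < rank kappa y.
Proof.
move=> xy; rewrite !rankE; apply/proper_card/properP; split.
  by apply/subsetP => z; rewrite !in_set => /ltn_trans; apply.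
by exists x; rewrite in_set ?ltnn.
Qed.

Lemma rank_ltn kappa x y : injective kappa ->
  (rank kappa x < rank kappa y) = (kappa x < kappa y).
Proof.
move=> inj.
case: (ltngtP (kappa x) (kappa y)) => [/ltn_rank //|/ltn_rank|/inj->].
  by case: ltngtP.
by rewrite ltnn.
Qed.

Lemma linexts_inj (f : {ffun P -> 'I_n}) : f \in linexts -> injective f.
Proof. by rewrite in_set => /is_linextP[/bij_inj]. Qed.

Lemma linexts_lt (f : {ffun P -> 'I_n}) x y :
  f \in linexts -> (x < y)%O -> f x < f y.
Proof.
move=> fL; have inj := linexts_inj fL; move: fL; rewrite in_set.
case/is_linextP=> _ mf xy; rewrite ltn_neqAle mf ?ltW // andbT.
by apply: contraTneq xy => /val_inj/inj ->; rewrite ltxx.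
Qed.

Lemma linexts_onto (f : {ffun P -> 'I_n}) (k : 'I_n) :
  f \in linexts -> exists x, f x = k.
Proof. by rewrite in_set => /is_linextP[[g _ gK] _]; exists (g k). Qed.

Lemma rank_linexts kappa : injective kappa ->
  {homo kappa : x y / (x < y)%O >-> x < y} -> rank kappa \in linexts.
Proof.
move=> inj hom; rewrite in_set; apply/is_linextP; split.
  apply: inj_card_bij; last by rewrite card_ord.
  move=> x y E; apply: (inj); move: (rank_ltn x y inj) (rank_ltn y x inj).
  by rewrite E ltnn; case: ltngtP.
move=> x y; rewrite le_eqVlt => /orP[/eqP -> //|/hom/ltn_rank].
exact: ltnW.
Qed.

Lemma rank_of_linext (f : {ffun P -> 'I_n}) : f \in linexts ->
  rank (fun x => f x) = f.
Proof.
move=> fL; apply/ffunP => x; apply: val_inj; rewrite /= rankE.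
have bf : bijective f by move: fL; rewrite in_set => /is_linextP[].
rewrite (_ : [set y | _] = f @^-1: [set k : 'I_n | k < f x]); last first.
  by apply/setP => y; rewrite !in_set.
rewrite on_card_preimset; last by apply: onW_bij.
rewrite -sum1dep_card -(big_ord_widen n (fun=> 1)) ?sum1_card ?card_ord //.
exact: ltnW.
Qed.

Lemma eq_linexts (f f' : {ffun P -> 'I_n}) :
    f \in linexts -> f' \in linexts ->
    (forall x y, (f x < f y) = (f' x < f' y)) -> f = f'.
Proof.
move=> fL fL' E; rewrite -(rank_of_linext fL) -(rank_of_linext fL').
apply/ffunP => x; apply: val_inj; rewrite /= !rankE.
by apply: eq_card => y; rewrite !in_set E.
Qed.

Lemma lower_lt_pos (f : {ffun P -> 'I_n}) x : f \in linexts ->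
  lower f x < pos f x.
Proof.
move=> fL; rewrite /pos ltnS; apply/bigmax_leqP => z zx.
exact: linexts_lt.
Qed.

Lemma pos_lt_upper (f : {ffun P -> 'I_n}) x : f \in linexts ->
  pos f x < upper f x.
Proof.
move=> fL; rewrite /upper leq_bigmin; apply/andP; split.
  by rewrite /pos ltnS ltn_ord.
apply/forallP => z; apply/implyP => xz; exact: linexts_lt.
Qed.

Lemma upper_le (f : {ffun P -> 'I_n}) x : upper f x <= n.+1.
Proof.
by have := leqnn (upper f x); rewrite {2}/upper leq_bigmin => /andP[].
Qed.

Lemma upper_le_pos (f : {ffun P -> 'I_n}) x z :
  (x < z)%O -> upper f x <= pos f z.
Proof.
move=> xz; have := leqnn (upper f x); rewrite {2}/upper leq_bigmin.
by case/andP=> _ /forallP/(_ z); rewrite xz.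
Qed.

End Ranks.

(** * Monotone maps built from a linear extension and a tuple of gaps *)

Section GapMaps.
Context {d : Order.disp_t} {P : finPOrderType d}.
Variable s : nat.
Local Notation n := #|P|.
Local Notation m := (s + n).
Local Notation Om := (@monotone_maps d P m).
Implicit Types (x y z : P) (f : {ffun P -> 'I_n}) (t : n.+1.-tuple 'I_s.+1).

Definition gaps : {set n.+1.-tuple 'I_s.+1} :=
  [set t : n.+1.-tuple 'I_s.+1 | \sum_(i <- t) i == s].

Lemma card_gaps : #|gaps| = 'C(n + s, n).
Proof. exact: card_ord_partitions. Qed.

Lemma sum_gaps t : t \in gaps -> \sum_(i < n.+1) tnth t i = s.
Proof. by rewrite in_set big_tuple => /eqP. Qed.

(* [tnth t i] counts the unused values between the positions [i] and [i.+1];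
   the value at position [j] is [gap_pos t j - 1], with virtual values -1 and
   [m] at the positions 0 and [n.+1]. *)
Definition gap_pos t (j : nat) : nat := \sum_(i < n.+1 | i < j) tnth t i + j.

Definition gap_map f t : {ffun P -> 'I_m.+1} :=
  [ffun x => inord (gap_pos t (pos f x)).-1].

Lemma gap_pos0 t : gap_pos t 0 = 0.
Proof. by rewrite /gap_pos big_pred0. Qed.

Lemma gap_pos_last t : t \in gaps -> gap_pos t n.+1 = m.+1.
Proof.
move=> tG; rewrite /gap_pos addnS -[in RHS](sum_gaps tG); congr (_ + _).+1.
by apply: eq_bigl => i; rewrite ltn_ord.
Qed.

Lemma gap_posD t j k : j <= k ->
  gap_pos t k = gap_pos t j + \sum_(i < n.+1 | j <= i < k) tnth t i + (k - j).
Proof.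
move=> jk; rewrite /gap_pos (bigID (fun i : 'I__ => i < j)) /=.
have -> : \sum_(i < n.+1 | (i < k) && (i < j)) tnth t i =
    \sum_(i < n.+1 | i < j) tnth t i by apply: eq_bigl => i; lia.
have -> : \sum_(i < n.+1 | (i < k) && ~~ (i < j)) tnth t i =
    \sum_(i < n.+1 | j <= i < k) tnth t i by apply: eq_bigl => i; lia.
have aux u v : u + v + k = u + j + v + (k - j) by lia.
exact: aux.
Qed.

Lemma gap_pos_mono t j k : j <= k -> gap_pos t j + (k - j) <= gap_pos t k.
Proof. by move=> jk; rewrite (gap_posD t jk) leq_add2r leq_addr. Qed.

Lemma gap_mapE f t x : t \in gaps ->
  (gap_map f t x).+1 = gap_pos t (pos f x) :> nat.
Proof.
move=> tG; have := gap_pos_mono t (leq0n (pos f x)); rewrite gap_pos0 subn0.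
have fx : pos f x <= n.+1 by rewrite /pos ltnS ltnW.
have := gap_pos_mono t fx; rewrite gap_pos_last // => H1 H2.
by rewrite ffunE inordK; move: H1 H2 fx; rewrite /pos; lia.
Qed.

Lemma gap_map_ltn f t x y : t \in gaps ->
  (gap_map f t x < gap_map f t y) = (f x < f y).
Proof.
move=> tG.
have lt a b : f a < f b -> gap_map f t a < gap_map f t b.
  move=> ab; rewrite -ltnS !gap_mapE //.
  have /(gap_pos_mono t) : pos f a <= pos f b by rewrite /pos ltnS ltnW.
  by rewrite /pos; lia.
case: (ltngtP (f x) (f y)) => [/lt //|/lt|E]; first by case: ltngtP.
by rewrite -ltnS !gap_mapE // /pos E ltnn.
Qed.

Lemma gap_map_mem f t : f \in linexts -> t \in gaps -> gap_map f t \in Om.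
Proof.
move=> fL tG; apply/monotone_mapsP => x y xy; rewrite leqNgt gap_map_ltn //.
by rewrite -leqNgt; move: fL; rewrite in_set => /is_linextP[_]; apply.
Qed.

(** [f] is read off from the order of the values, then [t] from the differences of consecutive
    values, with [gap_pos_last] closing the last gap. *)
Lemma gap_map_inj :
  {in setX linexts gaps &, injective (fun u => gap_map u.1 u.2)}.
Proof.
move=> [f t] [f' t'] /setXP[/= fL tG] /setXP[/= fL' tG'] E.
have Ef : f = f'.
  by apply: eq_linexts => // x y; rewrite -(gap_map_ltn _ _ _ tG) E gap_map_ltn.
subst f'; congr (_, _).
have Eg j : j <= n.+1 -> gap_pos t j = gap_pos t' j.
  case: j => [|j]; first by rewrite !gap_pos0.
  rewrite ltnS leq_eqVlt => /orP[/eqP ->|jn]; first by rewrite !gap_pos_last.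
  have [x fx] := linexts_onto (Ordinal jn) fL.
  have := gap_mapE f x tG; rewrite E (gap_mapE f x tG').
  by rewrite /pos fx.
apply: eq_from_tnth => i; apply: val_inj => /=.
have := Eg i.+1 (ltn_ord i).
rewrite !(gap_posD _ (leqnSn i)) (Eg i (ltnW (ltn_ord i))).
have one (u : n.+1.-tuple 'I_s.+1) :
    \sum_(k < n.+1 | i <= k < i.+1) tnth u k = tnth u i.
  by rewrite (big_pred1 i) // => k /=; rewrite ltnS -eqn_leq eq_sym.
by rewrite !one => /addIn/addnI.
Qed.

(** Only an inequality, because [gap_map] misses the maps with ties. *)
Lemma sum_gap_map (F : {ffun P -> 'I_m.+1} -> nat) :
  \sum_(f in linexts) \sum_(t in gaps) F (gap_map f t) <=
  \sum_(g : {ffun P -> 'I_m.+1} | g \in Om) F g.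
Proof.
rewrite pair_big /=.
rewrite (eq_bigl (fun u => u \in setX linexts gaps)); last first.
  by case=> f t; rewrite in_setX.
rewrite -(big_imset _ gap_map_inj) /=.
rewrite [X in _ <= X](bigID
  (mem [set gap_map u.1 u.2 | u in setX linexts gaps])) /=.
apply: leq_trans (leq_addr _ _); apply: eq_leq; apply: eq_bigl => g.
apply/idP/andP => [gI|[]//]; split=> //.
by case/imsetP: gI => -[f t] /setXP[fL tG] ->; apply: gap_map_mem.
Qed.

Lemma card_linexts_gaps : #|@linexts d P| * #|gaps| <= #|Om|.
Proof.
have := sum_gap_map (fun=> 1); rewrite [X in _ <= X]sum1_card.
by under eq_bigr => f _ do rewrite sum1_card; rewrite sum_nat_const.
Qed.

Lemma win_width_gap_map f t x : f \in linexts -> t \in gaps ->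
  \sum_(i < n.+1 | lower f x <= i < upper f x) tnth t i <=
  win_width (gap_map f t) x.
Proof.
move=> fL tG; have lo := lower_lt_pos x fL; have hi := pos_lt_upper x fL.
have lu : lower f x <= upper f x by apply: ltnW (ltn_trans lo hi).
have /(gap_pos_mono t) := upper_le f x; rewrite gap_pos_last // => up_m.
(* These two bounds give away at most 2 units of width, and upper f x - lower f x >= 2 makes up for
   them. *)
have Hhi : gap_pos t (upper f x) - 2 <= win_hi (gap_map f t) x.
  rewrite leq_bigmin; apply/andP; split; first by lia.
  apply/forallP => z; apply/implyP => xz.
  have /(gap_pos_mono t) := upper_le_pos f xz.
  by rewrite -(gap_mapE f z tG); lia.
have Hlo : win_lo (gap_map f t) x <= gap_pos t (lower f x).
  apply/bigmax_leqP => z zx; apply: ltnW; rewrite gap_mapE //.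
  have zl : pos f z <= lower f x by apply: (@leq_bigmax_cond _ _ (pos f)).
  by apply: leq_trans (gap_pos_mono t zl); apply: leq_addr.
rewrite /win_width; have := gap_posD t lu; lia.
Qed.

Lemma gap_sym (i j : 'I_n.+1) :
  \sum_(t in gaps) tnth t i = \sum_(t in gaps) tnth t j.
Proof.
pose sw (t : n.+1.-tuple 'I_s.+1) := [tuple tnth t (tperm i j k) | k < n.+1].
have swK : involutive sw.
  by move=> t; apply: eq_from_tnth => k; rewrite !tnth_mktuple tpermK.
rewrite (reindex_inj (inv_inj swK)) /=; apply: eq_big => [t|t _].
  rewrite !in_set !big_tuple; congr (_ == _).
  rewrite [RHS](reindex_inj (@perm_inj _ (tperm i j))) /=.
  by apply: eq_bigr => k _; rewrite tnth_mktuple.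
by rewrite tnth_mktuple tpermL.
Qed.

(** By symmetry all n + 1 gaps have the same total, and they add up to s in each tuple. *)
Lemma sum_gap (i : 'I_n.+1) :
  n.+1 * (\sum_(t in gaps) tnth t i) = #|gaps| * s.
Proof.
have -> : n.+1 * (\sum_(t in gaps) tnth t i) =
    \sum_(j < n.+1) \sum_(t in gaps) tnth t i by rewrite sum_nat_const card_ord.
rewrite (eq_bigr _ (fun j _ => gap_sym i j)) exchange_big /= -sum_nat_const.
by apply: eq_bigr => t tG; rewrite sum_gaps.
Qed.

Lemma card_ord_between a b N : a <= b -> b <= N ->
  #|[pred i : 'I_N | a <= i < b]| = b - a.
Proof.
move=> ab bN; rewrite -sum1_card.
transitivity (\sum_(i < N | i < b) (a <= i : nat)).
  rewrite [LHS]big_mkcond [RHS]big_mkcond; apply: eq_bigr => i _ /=.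
  by rewrite inE /=; case: (a <= i); case: (i < b).
rewrite -(big_ord_widen N (fun i => a <= i : nat)) //.
by have := sum_leq_ord b (leq0n a); rewrite add0n.
Qed.

(** For fixed f the window of x contains upper f x - lower f x gaps, each of mean s / (n + 1). *)
Lemma sum_win_width x :
  s * #|gaps| * (\sum_(f in linexts) (upper f x - lower f x)) <=
  n.+1 * (\sum_(g : {ffun P -> 'I_m.+1} | g \in Om) win_width g x).
Proof.
apply: leq_trans (leq_mul (leqnn _) (sum_gap_map (fun g => win_width g x))).
rewrite !big_distrr; apply: leq_sum => f fL.
apply: (@leq_trans (n.+1 * \sum_(t in gaps)
    \sum_(i < n.+1 | lower f x <= i < upper f x) tnth t i)); last first.
  by rewrite leq_mul2l; apply: leq_sum => t tG; apply: win_width_gap_map.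
rewrite exchange_big big_distrr /=.
under eq_bigr => i _ do rewrite sum_gap.
rewrite sum_nat_const card_ord_between ?upper_le //.
  by rewrite mulnC [s * _]mulnC.
exact: ltnW (ltn_trans (lower_lt_pos x fL) (pos_lt_upper x fL)).
Qed.

End GapMaps.

(** * Encoding monotone maps by linear extensions and subsets *)

Section Encoding.
Context {d : Order.disp_t} {P : finPOrderType d}.
Variable m : nat.
Local Notation n := #|P|.
Local Notation Om := (@monotone_maps d P m).
Implicit Types (x y z : P) (g h : {ffun P -> 'I_m.+1}).

Lemma ltn_lex a b a' b' N : b < N -> a < a' -> a * N + b < a' * N + b'.
Proof.
move=> bN aa; apply: leq_trans (_ : a.+1 * N <= _); first by rewrite mulSn; lia.
by apply: leq_trans (leq_addr _ _); rewrite leq_mul2r aa orbT.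
Qed.

(** Strictly increasing along [P], hence fit for breaking ties in accordance with the order. *)
Definition down x : nat := #|[set y | (y <= x)%O]|.

(* Orders [P] by the value of [g], breaking ties by a fixed linear extension. *)
Definition tie_key g x : nat := (g x * n.+1 + down x) * n + enum_rank x.

Lemma down_le x : down x < n.+1.
Proof. by rewrite ltnS max_card. Qed.

Lemma down_lt x y : (x < y)%O -> down x < down y.
Proof.
move=> xy; apply/proper_card/properP; split.
  by apply/subsetP => z; rewrite !in_set => /le_trans; apply; apply: ltW.
by exists y; rewrite in_set ?lexx // lt_geF.
Qed.

Lemma tie_key_lt g x y : g x < g y -> tie_key g x < tie_key g y.
Proof.
by move=> xy; apply: ltn_lex => //; apply: ltn_lex => //; apply: down_le.
Qed.

Lemma tie_key_homo g : g \in Om ->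
  {homo tie_key g : x y / (x < y)%O >-> x < y}.
Proof.
move/monotone_mapsP=> mg x y xy; apply: ltn_lex => //.
by rewrite -addnS leq_add ?down_lt // leq_mul2r mg ?orbT ?ltW.
Qed.

Lemma tie_key_inj g : injective (tie_key g).
Proof.
move=> x y /(congr1 (fun k => k %% n)).
rewrite /tie_key !modnMDl !modn_small //.
by move/val_inj/enum_rank_inj.
Qed.

Definition tie_rank g : {ffun P -> 'I_n} := rank (tie_key g).

Lemma tie_rank_linexts g : g \in Om -> tie_rank g \in linexts.
Proof.
by move=> gO; apply: rank_linexts; [apply: tie_key_inj | apply: tie_key_homo].
Qed.

Lemma tie_rank_lt g x y : g x < g y -> tie_rank g x < tie_rank g y.
Proof. by move=> xy; apply/ltn_rank/tie_key_lt. Qed.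

Lemma tie_rank_le g x y : tie_rank g x < tie_rank g y -> g x <= g y.
Proof. by apply: contraTleq => /tie_rank_lt; case: ltngtP. Qed.

(** Adding the rank separates equal values, as in the usual passage from multisets to sets. *)
Definition spread_map g x : 'I_(m + n).+1 := inord (g x + tie_rank g x).
Definition spread_set g : {set 'I_(m + n).+1} := [set spread_map g x | x : P].

Lemma spread_mapE g x : spread_map g x = g x + tie_rank g x :> nat.
Proof.
rewrite /spread_map inordK //.
by rewrite ltnS leq_add // ?leq_ffun_ord // ltnW.
Qed.

Lemma spread_map_ltn g x y :
  (spread_map g x < spread_map g y) = (tie_rank g x < tie_rank g y).
Proof.
have lt a b : tie_rank g a < tie_rank g b -> spread_map g a < spread_map g b.
  by move=> ab; rewrite !spread_mapE -addnS leq_add // tie_rank_le.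
case: (ltngtP (tie_rank g x) (tie_rank g y)) => [/lt //|/lt|E].
  by case: ltngtP.
suff -> : x = y by rewrite ltnn.
apply: (@tie_key_inj g); apply/eqP; case: ltngtP => // /ltn_rank.
  by rewrite -/(tie_rank g) E ltnn.
by rewrite -/(tie_rank g) E ltnn.
Qed.

Lemma spread_map_inj g : g \in Om -> injective (spread_map g).
Proof.
move=> gO x y E; apply: (linexts_inj (tie_rank_linexts gO)).
apply: val_inj; apply/eqP.
move: (spread_map_ltn g x y) (spread_map_ltn g y x); rewrite E ltnn /=.
by case: ltngtP.
Qed.

Lemma card_spread_below g x : g \in Om ->
  #|[set k in spread_set g | k < spread_map g x]| = tie_rank g x.
Proof.
move=> gO; rewrite -[in RHS](rank_of_linext (tie_rank_linexts gO)) rankE.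
rewrite -(card_imset _ (spread_map_inj gO)); apply: eq_card => k.
apply/setIdP/imsetP => [[/imsetP[z _ ->]]|[z]].
  by rewrite spread_map_ltn => zx; exists z; rewrite // in_set.
by rewrite in_set -spread_map_ltn => zx ->; split=> //; apply: imset_f.
Qed.

(** By [card_spread_below], [spread_map g x] is the element of [spread_set g] with a prescribed
    number of smaller ones; subtracting the rank recovers [g x]. *)
Lemma spread_inj g h : g \in Om -> h \in Om ->
  tie_rank g = tie_rank h -> spread_set g = spread_set h -> g = h.
Proof.
move=> gO hO Er Es.
have le a b x : a \in Om -> b \in Om -> tie_rank a = tie_rank b ->
    spread_set a = spread_set b -> spread_map a x <= spread_map b x.
  move=> aO bO Erab Esab; rewrite leqNgt; apply/negP => ba.
  have := card_spread_below x aO; rewrite Erab -(card_spread_below x bO) => E.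
  suff : #|[set k in spread_set b | k < spread_map b x]| <
      #|[set k in spread_set a | k < spread_map a x]| by rewrite E ltnn.
  apply/proper_card/properP; split.
    apply/subsetP => k /setIdP[kb kx]; apply/setIdP.
    split; first by rewrite Esab.
    exact: ltn_trans kx ba.
  exists (spread_map b x); first by apply/setIdP; rewrite Esab imset_f.
  by rewrite in_set ltnn andbF.
apply/ffunP => x; apply: val_inj; apply/eqP => /=.
have : spread_map g x = spread_map h x :> nat.
  by apply/eqP; rewrite eqn_leq !le.
by rewrite !spread_mapE Er => /addIn ->.
Qed.

Lemma card_le_linexts (S : {set {ffun P -> 'I_m.+1}})
    (L : {set {ffun P -> 'I_n}}) :
    S \subset Om -> {in S, forall g, tie_rank g \in L} ->
  #|S| <= #|L| * 'C((m + n).+1, n).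
Proof.
move=> /subsetP SO SL.
rewrite -[in 'C(_, _)](card_ord (m + n).+1) -card_draws -cardsX.
rewrite -(@card_in_imset _ _ (fun g => (tie_rank g, spread_set g)) S).
  apply/subset_leq_card/subsetP => _ /imsetP[g gS ->].
  rewrite in_setX SL //= in_set card_imset //.
  exact/spread_map_inj/SO.
by move=> g h /SO gO /SO hO [Er Es]; apply: spread_inj.
Qed.

End Encoding.

(** * A binomial estimate and the packing of intervals *)

Lemma expn_ffact_bin s n N : s ^ n * 'C(N, n) <= N ^ n * 'C(n + s, n).
Proof.
(* After multiplication by n! the factors compare one by one: N - i <= N and s <= n + s - i for i <
   n. *)
rewrite -(leq_pmul2r (fact_gt0 n)) -!mulnA !bin_ffact mulnC leq_mul //.
  rewrite ffact_prod -[X in N ^ X]card_ord -prod_nat_const.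
  by apply: leq_prod => i _; apply: leq_subr.
rewrite ffact_prod -[X in s ^ X]card_ord -prod_nat_const.
by apply: leq_prod => i _; have := ltn_ord i; lia.
Qed.

Section RealEstimates.
Local Open Scope ring_scope.

(** With u = n c / s, the ratio of the two binomials is at most (1 + c / s)^n <= e^u, and 1 - u <=
    e^(-u). *)
Lemma bin_ratio (R : realType) s n c : (0 < s)%N ->
  (1 - (n * c)%:R / s%:R) * 'C(s + c, n)%:R <= 'C(n + s, n)%:R :> R.
Proof.
move=> s0; have s_gt0 : 0 < s%:R :> R by rewrite ltr0n.
set u : R := _ / _; set H : R := 'C(s + c, n)%:R.
have H0 : 0 <= H by rewrite ler0n.
have := expn_ffact_bin s n (s + c); rewrite -(ler_nat R) !natrM !natrX -/H.
set G : R := 'C(n + s, n)%:R => key.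
have G0 : 0 <= G by rewrite ler0n.
have sc : ((s + c)%:R / s%:R) ^+ n <= expR u :> R.
  rewrite natrD mulrDl divff ?gt_eqF //.
  apply: (@le_trans _ _ (expR (c%:R / s%:R) ^+ n)).
    by rewrite lerXn2r ?nnegrE ?expR_ge1Dx ?expR_ge0 // addr_ge0 // divr_ge0.
  by rewrite -expRM_natl /u natrM mulrA.
have HG : H <= expR u * G.
  rewrite -(ler_pM2l (exprn_gt0 n s_gt0)) (le_trans key) //.
  rewrite mulrA ler_wpM2r // mulrC -ler_pdivrMr ?exprn_gt0 //.
  by rewrite -expr_div_n.
have [u1|u1] := leP (1 - u) 0.
  by apply: le_trans G0; rewrite mulr_le0_ge0.
apply: le_trans (ler_wpM2l (ltW u1) HG) _.
rewrite mulrA -[leRHS]mul1r ler_wpM2r //.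
rewrite -[leRHS](_ : expR (- u) * expR u = 1); last first.
  by rewrite -expRD addNr expR0.
by rewrite ler_wpM2r ?expR_ge0 // expR_ge1Dx.
Qed.

(** Induction removing the interval with the largest left endpoint [M x]: the others end by [M x],
    which becomes the new bound. *)
Lemma interval_packing (R : realType) (T : finType) (M w : T -> R)
    (X : {set T}) B :
    0 <= B -> {in X, forall x, 0 <= M x /\ M x + w x <= B} ->
    {in X &, forall x y, x != y -> M x <= M y -> M x + w x <= M y} ->
  \sum_(x in X) w x <= B.
Proof.
move: {2}#|X| (erefl #|X|) => k.
elim: k X B => [|k IHk] X B Xk B0 HB Hsep.
  by move/eqP: Xk; rewrite cards_eq0 => /eqP ->; rewrite big_set0.
have /card_gt0P[x0 x0X] : (0 < #|X|)%N by rewrite Xk.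
case: (@arg_maxP _ _ _ x0 (fun x => x \in X) M x0X) => x xX xmax.
rewrite (big_setD1 x xX) /=; have [Mx Bx] := HB x xX.
suff : \sum_(y in X :\ x) w y <= M x by lra.
apply: IHk => //.
- by move: Xk; rewrite (cardsD1 x) xX => -[].
- move=> y /setD1P[yx yX]; have [My _] := HB y yX; split=> //.
  by apply: Hsep => //; apply: xmax.
- by move=> y z /setD1P[_ yX] /setD1P[_ zX]; apply: Hsep.
Qed.

End RealEstimates.

(** * Transfer between monotone maps and linear extensions *)

Section Comparison.
Context {d : Order.disp_t} {P : finPOrderType d} (R : realType).
Variable s : nat.
Local Notation n := #|P|.
Local Notation m := (s + n).
Local Notation maps := {ffun P -> 'I_m.+1}.
Local Notation Om := (@monotone_maps d P m).
Local Notation L := (@linexts d P).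
Local Notation H := 'C((m + n).+1, n).
Implicit Types (x y z : P).

Lemma card_monotone_maps_le : #|Om| <= #|L| * H.
Proof. by apply: card_le_linexts => // g; apply: tie_rank_linexts. Qed.

Lemma card_diff_lt_le x y :
  #|diff_lt m x y| <= #|[set f in L | pos f x < pos f y]| * H.
Proof.
apply: card_le_linexts.
  by apply/subsetP => g; rewrite mem_diff_lt => /andP[].
move=> g; rewrite mem_diff_lt => /andP[gO gxy]; rewrite in_set.
by rewrite tie_rank_linexts //= /pos ltnS tie_rank_lt.
Qed.

Lemma card_linexts_gt0 : 0 < #|L|.
Proof.
have := leq_trans (monotone_maps_gt0 (P := P) m) card_monotone_maps_le.
by rewrite muln_gt0 => /andP[].
Qed.

Local Open Scope ring_scope.

Lemma winE x :
  win R x = (\sum_(f in L) (upper f x - lower f x))%:R / #|L|%:R.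
Proof.
rewrite /win /expect natr_sum; congr (_ / _); apply: eq_bigr => f fL.
rewrite natrB //.
by apply: ltnW; apply: ltn_trans (lower_lt_pos x fL) (pos_lt_upper x fL).
Qed.

Lemma win_ge2 x : 2 <= win R x.
Proof.
rewrite winE ler_pdivlMr ?ltr0n ?card_linexts_gt0 // -natrM ler_nat.
rewrite mulnC -sum_nat_const; apply: leq_sum => f fL.
by have := lower_lt_pos x fL; have := pos_lt_upper x fL; lia.
Qed.

Lemma win_le x : win R x <= n.+1%:R.
Proof.
rewrite winE ler_pdivrMr ?ltr0n ?card_linexts_gt0 // -natrM ler_nat.
rewrite mulnC -sum_nat_const; apply: leq_sum => f fL.
exact: leq_trans (leq_subr _ _) (upper_le f x).
Qed.

Definition mean_val x : R := (\sum_(g : maps | g \in Om) g x)%:R / #|Om|%:R.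
(** Half of win(x) times the mean gap s / (n + 1); the half leaves room for the maps with ties. *)
Definition weight x : R := s%:R * win R x / (2 * n.+1%:R).

Lemma mean_val_ge0 x : 0 <= mean_val x.
Proof. by rewrite divr_ge0. Qed.

Lemma mean_val_le x : mean_val x <= m%:R.
Proof.
rewrite ler_pdivrMr ?ltr0n ?monotone_maps_gt0 // -natrM ler_nat mulnC.
by rewrite -sum_nat_const; apply: leq_sum => g _; apply: leq_ffun_ord.
Qed.

(** [sum_win_width] rests on the maps from [gap_map]; by the hypothesis these number at least half
    of the bound |L| H for all maps. *)
Lemma weight_win_width x :
    1 / 2 * H%:R <= #|@gaps d P s|%:R :> R ->
  #|Om|%:R * weight x <=
    (\sum_(g : maps | g \in Om) win_width g x)%:R.
Proof.
move=> HG; have n0 : 0 < n.+1%:R :> R by rewrite ltr0n.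
have L0 : 0 < #|L|%:R :> R by rewrite ltr0n card_linexts_gt0.
have := sum_win_width s x; rewrite -(ler_nat R) !natrM.
have -> : (\sum_(f in L) (upper f x - lower f x))%:R = #|L|%:R * win R x :> R.
  by rewrite winE mulrC divfK ?gt_eqF.
have := card_monotone_maps_le; rewrite -(ler_nat R) natrM => HA HW.
rewrite -(ler_pM2l n0) (le_trans _ HW) //.
have w0 : 0 <= s%:R * win R x.
  by rewrite mulr_ge0 // (le_trans _ (win_ge2 x)).
have -> : n.+1%:R * (#|Om|%:R * weight x) =
    1 / 2 * #|Om|%:R * (s%:R * win R x).
  rewrite /weight; move: n0 => /gt_eqF/negbT; move: (n.+1%:R : R) => u u0.
  by field.
have -> : s%:R * #|@gaps d P s|%:R * (#|L|%:R * win R x) =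
  #|@gaps d P s|%:R * #|L|%:R * (s%:R * win R x) by ring.
rewrite ler_wpM2r //; apply: le_trans (ler_wpM2l _ HA) _; first by lra.
have -> : 1 / 2 * (#|L|%:R * H%:R) = 1 / 2 * H%:R * #|L|%:R :> R by ring.
by rewrite ler_pM2r.
Qed.

(** Each linear extension is the [tie_rank] of at most H maps, while |Om| >= |L| |gaps| >= (1 - u)
    |L| H; so the bound of [diff_lt_grunbaum] loses at most u in the transfer. *)
Lemma prob_lt_ge x y (W : nat) (w eta u : R) :
    0 < w -> 0 <= eta -> 0 <= u ->
    (1 - u) * H%:R <= #|@gaps d P s|%:R ->
    #|Om|%:R * w <= W%:R ->
    (forall j, #|diff_eq m x y j| * W <= 8 * #|Om| ^ 2)%N ->
    mean_val y - mean_val x <= eta * w ->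
  (expR 1)^-1 - (8 * (expR 1 + 2) / w + 8 * eta + u) <=
    prob R (fun f => pos f y < pos f x)%N.
Proof.
move=> w0 eta0 u0 HG HW Hj Hmean.
have A0 : 0 < #|Om|%:R :> R by rewrite ltr0n monotone_maps_gt0.
have L0 : 0 < #|L|%:R :> R by rewrite ltr0n card_linexts_gt0.
have H0 : 0 < H%:R :> R by rewrite ltr0n bin_gt0; lia.
(* An integer bound for the mean of g y - g x, at most eta w + 1. *)
pose k := (Num.truncn (eta * w)).+1.
have k_gt : eta * w < k%:R by rewrite truncnS_gt.
have k_le : k%:R <= eta * w + 1.
  by rewrite -natr1 lerD2r truncn_le // mulr_ge0 // ltW.
have Hk : (\sum_(g : maps | g \in Om) g y <=
    \sum_(g : maps | g \in Om) g x + k * #|Om|)%N.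
  rewrite -(ler_nat R) natrD natrM -(ler_pM2r (x := #|Om|%:R^-1)) ?invr_gt0 //.
  rewrite mulrDl mulfK ?gt_eqF // -/(mean_val y) -/(mean_val x).
  lra.
have G := @diff_lt_grunbaum _ P m R x y W k Hj Hk.
have lt_le : #|diff_lt m y x|%:R <= #|Om|%:R :> R.
  rewrite ler_nat; apply/subset_leq_card/subsetP => g.
  by rewrite mem_diff_lt => /andP[].
set q := #|diff_lt m y x|%:R / #|Om|%:R : R.
have q1 : q <= 1 by rewrite ler_pdivrMr // mul1r.
have q0 : 0 <= q by rewrite divr_ge0.
have Gq : (expR 1)^-1 <= q + 8 * (expR 1 + 2) / w + 8 * eta.
  have W0 : 0 < W%:R :> R by apply: lt_le_trans HW; rewrite mulr_gt0.
  have e0 : 0 < expR 1 :> R by exact: expR_gt0.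
  have AW : 8 * (expR 1 + k.+1%:R) * #|Om|%:R / W%:R <=
      8 * (expR 1 + 2) / w + 8 * eta.
    have -> : 8 * (expR 1 + 2) / w + 8 * eta =
        8 * (expR 1 + (eta * w + 2)) / w.
      by move: w0 => /gt_eqF/negbT w0; field.
    rewrite ler_pdivrMr // [leRHS]mulrAC ler_pdivlMr //.
    rewrite -[leLHS]mulrA; apply: ler_pM => //.
    - by rewrite mulr_ge0 // addr_ge0 // ltW.
    - by rewrite mulr_ge0 // ltW.
    - by rewrite ler_wpM2l // lerD2l -natr1; lra.
  have /= := ler_wpM2r (x := (W%:R * #|Om|%:R)^-1) _ G.
  rewrite invr_ge0 mulr_ge0 // => /(_ isT).
  have -> : W%:R * (#|Om|%:R / expR 1) / (W%:R * #|Om|%:R) = (expR 1)^-1 :> R.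
    move: W0 A0 e0 => /gt_eqF/negbT W0 /gt_eqF/negbT A0 /gt_eqF/negbT e0.
    by field; rewrite W0 A0 e0.
  have -> : (W%:R * #|diff_lt m y x|%:R +
      8 * (expR 1 + k.+1%:R) * #|Om|%:R ^+ 2) / (W%:R * #|Om|%:R) =
      q + 8 * (expR 1 + k.+1%:R) * #|Om|%:R / W%:R :> R.
    rewrite /q.
    move: W0 A0 => /gt_eqF/negbT W0 /gt_eqF/negbT A0.
    by field; rewrite W0 A0.
  by move=> ?; lra.
have qp : (1 - u) * q <= prob R (fun f => pos f y < pos f x)%N.
  rewrite /prob ler_pdivlMr //.
  have := card_diff_lt_le y x; rewrite -(ler_nat R) natrM => D.
  rewrite -(ler_pM2r H0) (le_trans _ D) //.
  have -> : #|diff_lt m y x|%:R = q * #|Om|%:R by rewrite divfK ?gt_eqF.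
  have := @card_linexts_gaps _ P s; rewrite -(ler_nat R) natrM => LG.
  apply: le_trans (ler_wpM2l q0 LG).
  have -> : (1 - u) * q * #|L|%:R * H%:R =
      q * (#|L|%:R * ((1 - u) * H%:R)) by ring.
  by rewrite ler_wpM2l // ler_wpM2l // ltW.
have : u * q <= u by rewrite ler_piMr.
lra.
Qed.

(** Both orders are bounded through the window of x alone, as the point masses of g y - g x and g x
    - g y correspond under reflection. *)
Lemma delta_ge x y (eta u : R) :
    (0 < s)%N -> x != y -> 0 <= eta -> 0 <= u <= 1 / 2 ->
    (1 - u) * H%:R <= #|@gaps d P s|%:R ->
    `|mean_val x - mean_val y| <= eta * weight x ->
  (expR 1)^-1 - (8 * (expR 1 + 2) * n.+1%:R / s%:R + 8 * eta + u) <=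
    delta R x y.
Proof.
move=> s0 xy eta0 /andP[u0 u2] HG Hmean.
have n0 : 0 < n.+1%:R :> R by rewrite ltr0n.
have s_gt0 : 0 < s%:R :> R by rewrite ltr0n.
have w_ge : s%:R / n.+1%:R <= weight x.
  rewrite /weight ler_pdivlMr ?mulr_gt0 // mulrCA divfK ?gt_eqF //.
  by rewrite mulrC ler_pM2l // win_ge2.
have w0 : 0 < weight x by apply: lt_le_trans w_ge; rewrite divr_gt0.
have HW : #|Om|%:R * weight x <=
    (\sum_(g : maps | g \in Om) win_width g x)%:R.
  apply: weight_win_width; apply: le_trans HG.
  by rewrite ler_wpM2r //; lra.
have e0 : 0 < expR 1 :> R by exact: expR_gt0.
have inv_w : 8 * (expR 1 + 2) / weight x <=
    8 * (expR 1 + 2) * n.+1%:R / s%:R :> R.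
  rewrite -[leRHS]mulrA ler_pM2l; last by rewrite mulr_gt0 // addr_gt0.
  by rewrite -invf_div lef_pV2 // posrE // divr_gt0.
move: Hmean; rewrite ler_norml => /andP[Hm1 Hm2].
rewrite le_min; apply/andP; split.
- have := @prob_lt_ge y x _ _ _ _ w0 eta0 u0 HG HW
    (fun j => diff_eq_win_widthC _ j xy) Hm2; lra.
- have Hm : mean_val y - mean_val x <= eta * weight x by lra.
  have := @prob_lt_ge x y _ _ _ _ w0 eta0 u0 HG HW
    (fun j => diff_eq_win_width _ j xy) Hm; lra.
Qed.

End Comparison.

(** * Choice of the constants and the packing argument *)

Local Open Scope ring_scope.

Theorem theorem2p10 (R : realType) (eps : R) (eps_gt0 : 0 < eps) :
  exists C : R, forall (d : Order.disp_t) (P : finPOrderType d),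
    (0 < #|P|)%N ->
    forall X : {set P},
      C * #|P|%:R <= \sum_(x in X) win R x ->
      exists x y : P,
        [/\ x \in X, y \in X, x <> y & (expR 1)^-1 - eps < delta R x y].
Proof.
(* Then 8 eta = eps / 4 is a quarter of the error budget; the terms of order 1 / s take another
   quarter. *)
pose eta : R := eps / 32.
have eta0 : 0 < eta by rewrite divr_gt0.
(* With this constant the intervals of length eta * weight have total length at least (2 + 3 eta /
   4) s, exceeding the available (2 + eta / 2) s. *)
exists (8 / eta + 3) => d P n_gt0 X HX; set n := #|P| in n_gt0 HX.
have e0 : 0 < expR 1 :> R by exact: expR_gt0.
have n0 : 0 < n%:R :> R by rewrite ltr0n.
pose c : R := 8 * (expR 1 + 2) * n.+1%:R + (n * (n + n).+1)%:R.
have c0 : 0 <= c by rewrite addr_ge0 // !mulr_ge0 // addr_ge0 // ltW.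
(* The three summands ensure c / s <= eps / 4, c / s <= 1 / 2 and n <= s, where c / s collects the
   errors of [delta_ge] that vanish as s grows. *)
pose s := ((Num.truncn (4 * c / eps)).+1 + (Num.truncn (2 * c)).+1 + n)%N.
have s0 : (0 < s)%N by rewrite /s; lia.
have s_gt0 : 0 < s%:R :> R by rewrite ltr0n.
have s1 : 4 * c / eps <= s%:R.
  apply: le_trans (ltW (truncnS_gt _)) _; by rewrite ler_nat /s -addnA leq_addr.
have s2 : 2 * c <= s%:R.
  apply: le_trans (ltW (truncnS_gt _)) _; by rewrite ler_nat /s addnAC leq_addl.
have s3 : (n <= s)%N by rewrite /s leq_addl.
move: s s0 s_gt0 s1 s2 s3 => s s0 s_gt0 s1 s2 s3.
pose u : R := (n * (n + n).+1)%:R / s%:R.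
have cs1 : c / s%:R <= eps / 4.
  rewrite ler_pdivrMr //; move: s1; rewrite ler_pdivrMr //; lra.
have cs2 : c / s%:R <= 1 / 2 by rewrite ler_pdivrMr //; lra.
have cE : c / s%:R = 8 * (expR 1 + 2) * n.+1%:R / s%:R + u by rewrite mulrDl.
have t0 : 0 <= 8 * (expR 1 + 2) * n.+1%:R / s%:R :> R.
  by rewrite divr_ge0 // !mulr_ge0 // addr_ge0 // ltW.
have u0 : 0 <= u by rewrite divr_ge0.
have HG : (1 - u) * 'C((s + n + n).+1, n)%:R <= #|@gaps d P s|%:R.
  by have := @bin_ratio R s n (n + n).+1 s0; rewrite card_gaps addnS addnA.
have u2 : 0 <= u <= 1 / 2 by apply/andP; split; lra.
(* A pair with close means is as desired by [delta_ge]; without one, the intervals starting at the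
   means are disjoint. *)
have [|none] := boolP [exists x, exists y, [&& x \in X, y \in X, x != y &
    `|mean_val R s x - mean_val R s y| <= eta * weight R s x]].
  case/existsP=> x /existsP[y /and4P[xX yX xy Hxy]].
  exists x, y; split=> //; first exact/eqP.
  have := delta_ge s0 xy (ltW eta0) u2 HG Hxy; rewrite -/n /eta; lra.
have sep : {in X &, forall x y, x != y -> mean_val R s x <= mean_val R s y ->
    mean_val R s x + eta * weight R s x <= mean_val R s y}.
  move=> x y xX yX xy Mxy; rewrite leNgt; apply: contra none => lt.
  apply/existsP; exists x; apply/existsP; exists y; apply/and4P; split=> //.
  rewrite distrC ger0_norm ?subr_ge0 //; lra.
have wle (x : P) : weight R s x <= s%:R / 2.
  rewrite /weight ler_pdivrMr ?mulr_gt0 ?ltr0n // [leRHS]mulrA.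
  by rewrite divfK ?pnatr_eq0 // ler_pM2l // win_le.
have B0 : 0 <= (s + n)%:R + eta * (s%:R / 2) :> R.
  by rewrite addr_ge0 // mulr_ge0 ?ltW // divr_gt0.
have bounds : {in X, forall x, 0 <= mean_val R s x /\
    mean_val R s x + eta * weight R s x <= (s + n)%:R + eta * (s%:R / 2)}.
  move=> z _; split; first exact: mean_val_ge0.
  by rewrite lerD ?mean_val_le // ler_pM2l.
have := interval_packing B0 bounds sep.
rewrite -mulr_sumr /weight -mulr_suml -mulr_sumr => Hpack.
have n1 : 0 < n.+1%:R :> R by rewrite ltr0n.
have half : n%:R / n.+1%:R >= 1 / 2 :> R.
  rewrite ler_pdivlMr // -(natr1 n); have : 1 <= n%:R :> R by rewrite ler1n.
  lra.
have sn : (s + n)%:R <= 2 * s%:R :> R.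
  by rewrite natrD mulr_natl mulr2n lerD2l ler_nat.
have low : eta * (s%:R * ((8 / eta + 3) * n%:R) / (2 * n.+1%:R)) <=
    eta * (s%:R * (\sum_(x in X) win R x) / (2 * n.+1%:R)).
  by rewrite ler_pM2l // ler_pM2r ?invr_gt0 ?mulr_gt0 // ler_pM2l.
have lowE : eta * (s%:R * ((8 / eta + 3) * n%:R) / (2 * n.+1%:R)) =
    (8 + 3 * eta) / 2 * s%:R * (n%:R / n.+1%:R) :> R.
  move: eta0 n1 => /gt_eqF/negbT eta1 /gt_eqF/negbT n1.
  by move: (n.+1%:R : R) n1 (eta) eta1 => v v0 w w0; field; rewrite v0 w0.
have pos0 : 0 <= (8 + 3 * eta) / 2 * s%:R :> R.
  by rewrite mulr_ge0 // divr_ge0 // addr_ge0 // mulr_ge0 // ltW.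
have := ler_wpM2l pos0 half; rewrite -lowE => low2.
have es0 : 0 < eta * s%:R by rewrite mulr_gt0.
have := le_trans low2 (le_trans low Hpack).
have aux (a b k : R) : 0 < a * b -> k <= 2 * b ->
  (8 + 3 * a) / 2 * b * (1 / 2) <= k + a * (b / 2) -> False by lra.
by move/(aux _ _ _ es0 sn).
Qed.
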